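(* Let $X$ be a Tychonoff space. The following are equivalent: (1) $C_w(X)$ is completely metrizable; (2) $C_w(X)$ is Čech complete; (3) $C_w(X)$ is sieve complete; (4) $C_w(X)$ is hereditarily Baire; (5) $X$ is pseudocompact.
   Context: $C(X)$ is the set of all continuous functions $f:X\to\mathbb R$, where $\mathbb R$ carries the Euclidean metric, and $C^+(X)$ is the set of strictly positive continuous real-valued functions on $X$. For $f\in C(X)$ and $\varepsilon:X\to(0,\infty)$ put $B(f,\varepsilon)=\{g\in C(X): |f(x)-g(x)|<\varepsilon(x)\ \text{for all}\ x\in X\}$. The fine topology $\tau_w$ on $C(X)$ is the topology with base $\{B(f,\varepsilon): f\in C(X),\ \varepsilon\in C^+(X)\}$; $C_w(X)$ denotes the space $(C(X),\tau_w)$. A Tychonoff space is Čech complete if it is a $G_{\delta}$-subspace of a compactification of it. A space is sieve complete if it is a continuous open image of a Čech complete space. A space is a Baire space if every countable collection of dense open sets has dense intersection. A space $Z$ is hereditarily Baire if every nonempty closed subspace of $Z$ is a Baire space. A space is pseudocompact if every continuous real-valued function on it is bounded. *)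

(* Defs.v *)
From HB Require Import structures.
From mathcomp Require Import all_boot all_order all_algebra.
From mathcomp Require Import all_classical all_reals all_analysis.
From mathcomp Require Import borel_hierarchy.

Set Implicit Arguments.
Unset Strict Implicit.
Unset Printing Implicit Defensive.

Import Order.TTheory GRing.Theory Num.Theory.
Import numFieldNormedType.Exports.

Local Open Scope classical_set_scope.
Local Open Scope ring_scope.

Definition tychonoff_space (T : topologicalType) : Prop :=
  hausdorff_space T /\ completely_regular_space T.

Definition pseudocompact (R : realType) (T : topologicalType) : Prop :=
  forall f : T -> R, continuous f -> bounded_fun f.

(* The second conjunct says that [T] carries the initial topology along [i],
   so that [i] is a homeomorphism onto its range with the subspace topology. *)
Definition embedding (T K : topologicalType) (i : T -> K) : Prop :=
  injective i /\ (forall U : set T, open U <-> [set i @^-1` V | V in open] U).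

Definition homeomorphism (T K : topologicalType) (h : T -> K) : Prop :=
  embedding h /\ range h = setT.

Definition compactification (T K : topologicalType) (i : T -> K) : Prop :=
  [/\ compact [set: K], hausdorff_space K, embedding i & dense (range i)].

Definition cech_complete (T : topologicalType) : Prop :=
  tychonoff_space T /\
  exists (K : topologicalType) (i : T -> K),
    compactification i /\ Gdelta (range i).

Definition sieve_complete (T : topologicalType) : Prop :=
  exists (S : topologicalType) (f : S -> T),
    [/\ cech_complete S, continuous f, (forall U, open U -> open (f @` U))
      & range f = setT].

Definition baire_space (T : topologicalType) : Prop :=
  forall F : nat -> set T,
    (forall n, open (F n) /\ dense (F n)) -> dense (\bigcap_n F n).

(* A set [A] coerces to the subtype [set_type A], whose topology is the
   subspace topology. *)
Definition hereditarily_baire (T : topologicalType) : Prop :=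
  forall A : set T, closed A -> A !=set0 -> baire_space A.

(* The library's [completeType] is pointed; here completeness is spelled out
   so as not to exclude the empty space. *)
Definition complete_metric (R : realType) (M : metricType R) : Prop :=
  forall F : set_system M, ProperFilter F -> cauchy F -> exists x : M, F --> x.

Definition completely_metrizable (R : realType) (T : topologicalType) : Prop :=
  exists (M : metricType R) (h : T -> M), homeomorphism h /\ complete_metric M.

(* [Cw R X] is an alias of C(X), so that the fine topology does not clash with
   the other topologies the library puts on [continuousType X R]. *)
Definition Cw (R : realType) (X : topologicalType) : Type := continuousType X R.

Section fine_topology.
Variables (R : realType) (X : topologicalType).
Local Notation C := (continuousType X R).

Definition fine_ball (f : C) (e : X -> R) : set (Cw R X) :=
  [set g : C | forall x, `|f x - g x| < e x].

Definition fine_base_index : set (C * C) := [set fe : C * C | forall x, 0 < fe.2 x].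

Definition fine_base (fe : C * C) : set (Cw R X) := fine_ball fe.1 fe.2.

HB.instance Definition _ := Choice.copy (Cw R X) C.

HB.instance Definition _ := isPointed.Build C (cst 0 : C).

Let fine_base_cover : \bigcup_(i in fine_base_index) fine_base i = setT.
Proof.
apply/seteqP; split=> // g _; exists ((g : C), (cst 1 : C)) => /=.
  by move=> x /=.
by move=> x /=; rewrite subrr normr0.
Qed.

Let slack_continuous (f g e : C) : continuous (fun x => e x - `|f x - g x|).
Proof.
move=> x; apply: cvgB; first exact: cts_fun.
by apply: cvg_norm; apply: cvgB; exact: cts_fun.
Qed.

Let fine_base_join (i j : C * C) (t : Cw R X) :
    fine_base_index i -> fine_base_index j -> fine_base i t -> fine_base j t ->
  exists k, [/\ fine_base_index k, fine_base k t
    & fine_base k `<=` fine_base i `&` fine_base j].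
Proof.
case: i j => [f e] [f' e'] /= e0 e'0 fet f'et.
pose m := (fun x => e x - `|f x - (t : C) x|)
  \min (fun x => e' x - `|f' x - (t : C) x|).
have m_cts : continuous m.
  by move=> x; apply: continuous_min; exact: slack_continuous.
exists ((t : C), (mkcts m_cts : C)); split.
- by move=> x /=; rewrite /mkcts /m /= lt_min !subr_gt0 fet f'et.
- by move=> x /=; rewrite subrr normr0 /mkcts /m /= lt_min !subr_gt0 fet f'et.
- move=> g /= tg; split=> x /=; have := tg x;
    rewrite /= /mkcts /m /= lt_min => /andP[h1 h2].
  + by rewrite (le_lt_trans (ler_distD ((t : C) x) _ _))// addrC -ltrBrDr.
  + by rewrite (le_lt_trans (ler_distD ((t : C) x) _ _))// addrC -ltrBrDr.
Qed.

HB.instance Definition _ :=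
  isBaseTopological.Build (Cw R X) fine_base_cover fine_base_join.

End fine_topology.

(* Main.v *)
(** If [X] is pseudocompact, every positive continuous function is bounded away
    from 0, so the fine topology is that of the complete sup metric.  A complete
    metric space [M] is Cech complete: [x |-> min(1, d(x, .))] embeds it into
    the cube [[0,1]^M], and a point [p] of the closure lies in the image iff
    [inf p = 0], a G-delta condition.  Sieve complete spaces are hereditarily
    Baire because a closed set and dense open subsets of it pull back along a
    continuous open surjection to a closed part of a Cech complete space, where
    the compactness argument for Baire's theorem applies.  Finally, if [f] is
    continuous and unbounded, the functions vanishing on some [{|f| > m}] form a
    closed set in the fine topology which is the union over [m] of the nowhere
    dense closed sets of functions vanishing on [{|f| > m}]. *)
Require Import Defs.
From mathcomp Require Import all_boot all_order all_algebra.
From mathcomp Require Import all_classical all_reals all_analysis.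
From HB Require Import structures.
From mathcomp Require Import lra.

Set Implicit Arguments.
Unset Strict Implicit.
Unset Printing Implicit Defensive.

Import Order.TTheory GRing.Theory Num.Theory.
Import numFieldNormedType.Exports.

Local Open Scope classical_set_scope.
Local Open Scope ring_scope.

(** * Baire's theorem in compact Hausdorff and in sieve complete spaces *)

(** Regularity gives nested open sets [Vs n] meeting [P], each with closure inside the previous one
    and inside the corresponding [H n]; compactness gives a cluster point of their traces on [P]. It
    is found only in the closure of [P]: in the application [P] is an image in a compactification,
    and the sets [H n] bring the point back into that image. *)
Lemma compact_hausdorff_baire (K : topologicalType) (P V : set K)
    (H : nat -> set K) :
    compact [set: K] -> hausdorff_space K -> (forall n, open (H n)) ->
    (forall n W, open W -> W `&` P !=set0 -> W `&` P `&` H n !=set0) ->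
    open V -> V `&` P !=set0 ->
  V `&` closure P `&` \bigcap_n H n !=set0.
Proof.
move=> cK hK oH dH oV VP.
pose good (W : set K) := open W /\ W `&` P !=set0.
have shrink (nW : nat * {W | good W}) : exists W' : {W | good W},
    closure (sval W') `<=` sval nW.2 `&` H nW.1.
  case: nW => n [W [oW WP]] /=.
  have [p [[Wp Pp] Hp]] := dH n W oW WP.
  have [|N Np clN] := @compact_regular K p setT hK cK (@filterT _ _ _) (W `&` H n).
    by apply: open_nbhs_nbhs; split => //; exact: openI.
  have gN : good N°.
    split; first exact: open_interior.
    by exists p; split.
  exists (exist _ _ gN) => /=.
  by apply: subset_trans clN; apply: closureS; exact: interior_subset.
have [s sP] := choice shrink.
pose fix Vs n : {W | good W} :=
  if n is m.+1 then s (m, Vs m) else exist _ V (conj oV VP).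
have VsS n : closure (sval (Vs n.+1)) `<=` sval (Vs n) `&` H n by exact: sP.
have Vsle m n : (m <= n)%N -> sval (Vs n) `<=` sval (Vs m).
  elim: n => [|n IH]; first by rewrite leqn0 => /eqP ->.
  rewrite leq_eqVlt => /orP[/eqP -> //|/IH]; apply: subset_trans => x Vx.
  by have [] := VsS n x (subset_closure Vx).
pose F : set_system K := filter_from setT (fun n => sval (Vs n) `&` P).
have FF : ProperFilter F.
  apply: filter_from_proper; last by move=> n _; case: (svalP (Vs n)).
  apply: filter_from_filter; first by exists 0%N.
  move=> m n _ _; exists (maxn m n) => // x [Vx Px].
  by split; split=> //; apply: Vsle Vx; rewrite ?leq_maxl ?leq_maxr.
have [x [_ clx]] := cK F FF (@filterT _ _ _).
have xV n : closure (sval (Vs n) `&` P) x.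
  by move=> N Nx; apply: clx => //; exists n.
exists x; split; first split.
- have [] // := VsS 0%N x.
  by apply: closureS (xV 1%N) => y [].
- by apply: closureS (xV 0%N) => y [].
- move=> n _; have [] // := VsS n x.
  by apply: closureS (xV n.+1) => y [].
Qed.

Lemma sieve_complete_hereditarily_baire (T : topologicalType) :
  sieve_complete T -> hereditarily_baire T.
Proof.
move=> [S [f [[_ [K [i [[cK hK [_ openI_] _]] [G oG rG]]]]]]] cf opf surjf.
move=> A clA _ F oF O [a Oa] [W oW WO].
have /choice[D DP] n : exists D : set T, open D /\ set_val @^-1` D = F n.
  by have [[D oD DF] _] := oF n; exists D.
have /choice[E EP] n : exists E : set K, open E /\ i @^-1` E = f @^-1` (D n).
  have : open (f @^-1` D n) by apply: open_comp => //; case: (DP n).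
  by move=> /openI_[E oE EF]; exists E.
have [V oV VW] : [set i @^-1` V | V in open] (f @^-1` W).
  by apply/openI_; exact: open_comp.
have [s _ fs] : range f (val a) by rewrite surjf.
(* [E n] represents the dense open set [F n], while [G n] forces the resulting point into the copy
   of [S] in [K]. *)
have := @compact_hausdorff_baire K (i @` (f @^-1` A)) V
  (fun n => E n `&` G n) cK hK.
case.
- by move=> n; apply: openI => //; case: (EP n).
- move=> n U oU [_ [] /[swap] [[z Az <-] Ui]].
  have oiU : open (i @^-1` U) by apply/openI_; exists U.
  (* Since [f] is open, the trace of [U] on [S] has an open image, whose trace on [A] meets the
     dense set [F n]. *)
  have [] := (oF n).2 (set_val @^-1` (f @` (i @^-1` U))).
  + by exists (exist _ (f z) (mem_set Az)); exists z.
  + by exists (f @` (i @^-1` U)) => //; exact: opf.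
  move=> b [[t it ft] Fb]; exists (i t).
  have At : A (f t) by rewrite ft; exact: set_valP.
  split; first by split => //; exists t.
  split; last by have : range i (i t) by []; rewrite rG; exact.
  suff : (i @^-1` (E n)) t by [].
  rewrite (EP n).2 /= ft.
  by have [_] := DP n; rewrite -{1}/(F n) => DF; move: Fb; rewrite -DF.
- exact: oV.
- exists (i s); split; last first.
    by exists s => //=; rewrite fs; exact: set_valP.
  suff : (i @^-1` V) s by [].
  by rewrite VW /= fs; move: Oa; rewrite -WO.
move=> x [[Vx clx] EGx].
have [t _ tx] : range i x by rewrite rG => n _; case: (EGx n).
subst x.
(* [t] is a limit of points of the preimage of [A], which is closed because [f] is continuous. *)
have At : A (f t).
  suff : (f @^-1` A) t by [].
  have clfA : closed (f @^-1` A) by apply: preimage_closed.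
  apply: clfA => N; rewrite nbhsE => -[U [oU Ut] UN].
  have [Y oY YU] := (openI_ U).1 oU.
  have [|_ [[z Az <-] Yz]] := clx Y.
    by apply: open_nbhs_nbhs; split=> //; move: Ut; rewrite -YU.
  by exists z; split=> //; apply: UN; rewrite -YU.
exists (exist _ (f t) (mem_set At)); split.
  rewrite -WO /=.
  suff : (f @^-1` W) t by [].
  by rewrite -VW.
move=> n _; have [_ <-] := DP n.
suff : (f @^-1` D n) t by [].
by rewrite -(EP n).2 /=; case: (EGx n).
Qed.

(** * Transfer along embeddings, and compactification by closure of the image *)

Lemma embedding_continuous (T K : topologicalType) (i : T -> K) :
  embedding i -> continuous i.
Proof. by move=> [_ oi]; apply/continuousP => V oV; apply/oi; exists V. Qed.

Lemma embedding_hausdorff (T K : topologicalType) (i : T -> K) :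
  embedding i -> hausdorff_space K -> hausdorff_space T.
Proof.
move=> ei hK p q clpq; apply: ei.1; apply: hK => A B Ap Bq.
have ci := embedding_continuous ei.
by have [t [At Bt]] := clpq _ _ (ci p A Ap) (ci q B Bq); exists (i t).
Qed.

(** A function on [K] separating a point from a closed set pulls back along [i]. *)
Lemma embedding_tychonoff (R : realType) (T K : topologicalType) (i : T -> K) :
  embedding i -> tychonoff_space K -> tychonoff_space T.
Proof.
move=> ei [hK crK]; split; first exact: embedding_hausdorff ei hK.
move=> a B clB nBa.
have [V oV VB] := (ei.2 (~` B)).1 (closed_openC clB).
have nVa : ~ (~` V) (i a).
  by apply; suff : (i @^-1` V) a by []; rewrite VB.
have /(@uniform_separatorP _ R)[f [cf f01 f0 f1]] :=
  crK (i a) (~` V) (open_closedC oV) nVa.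
apply/(@uniform_separatorP _ R); exists (f \o i); split.
- by move=> x; apply: continuous_comp; [exact: embedding_continuous|exact: cf].
- by move=> _ [x _ <-]; apply: f01; exists (i x).
- by move=> _ [x -> <-]; apply: f0; exists (i a).
- move=> _ [x Bx <-]; apply: f1; exists (i x) => // Vx.
  by suff : (~` B) x by []; rewrite -VB.
Qed.

Lemma embedding_comp (T M K : topologicalType) (h : T -> M) (i : M -> K) :
  embedding h -> embedding i -> embedding (i \o h).
Proof.
move=> [ih oh] [ii oi]; split; first exact: inj_comp.
move=> U; split=> [/oh[V /oi[W oW <-] <-]|[W oW <-]]; first by exists W.
by apply/oh; exists (i @^-1` W) => //; apply/oi; exists W.
Qed.

Lemma homeomorphism_cech_complete (R : realType) (T M : topologicalType)
    (h : T -> M) :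
  homeomorphism h -> cech_complete M -> cech_complete T.
Proof.
move=> [eh sh] [tM [K [i [[cK hK ei di] Gi]]]].
split; first exact: embedding_tychonoff eh tM.
have rih : range (i \o h) = range i.
  apply/seteqP; split=> [_ [x _ <-]|_ [y _ <-]]; first by exists (h x).
  by have [x _ <-] : range h y by [rewrite sh]; exists x.
exists K, (i \o h); rewrite /compactification rih; split=> //; split=> //.
exact: embedding_comp.
Qed.

Lemma set_val_embedding (K : topologicalType) (A : set K) :
  embedding (set_val : A -> K).
Proof. by split=> //; exact: val_inj. Qed.

Lemma set_type_compact (K : topologicalType) (A : set K) :
  compact A -> compact [set: A].
Proof.
move=> cA F FF _.
have FA : F (set_val @^-1` A) by apply: filterE => x; exact: (set_valP x).
have [p [Ap clp]] := cA (set_val @ F) _ FA.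
exists (exist _ p (mem_set Ap)); split=> // U N FU.
rewrite nbhsE => -[_ [[W oW <-] Wp] WN].
have FU' : F (set_val @^-1` (set_val @` U)).
  by apply: filterS FU => u Uu; exists u.
have [_ [[u Uu <-] Wu]] := clp _ W FU' (open_nbhs_nbhs (conj oW Wp)).
by exists u; split=> //; exact: WN.
Qed.

Section closure_compactification.
Variables (T P : topologicalType) (k : T -> P) (B : set P).

Definition corestrict_closure (x : T) : closure (range k) :=
  exist _ (k x) (mem_set (subset_closure (imageT k x))).

Lemma closure_compactification :
  embedding k -> hausdorff_space P -> compact B -> range k `<=` B ->
  compactification corestrict_closure.
Proof.
move=> [ik ok] hP cB kB; split.
- apply: set_type_compact; apply: (subclosed_compact _ cB).
    exact: closed_closure.
  exact: subset_trans (closureS kB) (compact_closed hP cB).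
- exact: embedding_hausdorff (set_val_embedding _) hP.
- split=> [x y /(congr1 val)|U]; first exact: ik.
  split=> [/ok[V oV <-]|[_ [V oV <-] <-]].
    by exists (set_val @^-1` V) => //; exists V.
  by apply/ok; exists V.
- move=> O [p Op] [W oW WO].
  have Wp : W (set_val p) by move: Op; rewrite -WO.
  have [_ [[x _ <-] Wx]] := set_valP p W (open_nbhs_nbhs (conj oW Wp)).
  by exists (corestrict_closure x); split; [rewrite -WO|exists x].
Qed.

End closure_compactification.

(** * Cech completeness of complete metric spaces *)

Section truncated_distance.
Variables (R : realType) (M : metricType R).
Implicit Types (x y z : M).

(** Truncation at 1 puts the coordinates in a compact interval; [y] indexes the coordinate and [x]
    is the embedded point. *)
Definition truncated_dist y x : R := Num.min 1 (mdist x y).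

Local Notation P := (prod_topology (fun _ : M => R)).
Local Notation k := (join_product truncated_dist : M -> P).

Lemma truncated_dist_lip x y z :
  `|truncated_dist z x - truncated_dist z y| <= mdist x y.
Proof.
have xyz := metric_triangle x y z; have yxz := metric_triangle y x z.
have xy0 := mdist_ge0 x y.
move: yxz; rewrite [mdist y x]metric_sym => yxz.
rewrite /truncated_dist ler_norml.
by case: (leP 1 (mdist x z)) => ?; case: (leP 1 (mdist y z)) => ?;
  apply/andP; split; lra.
Qed.

Lemma truncated_dist_continuous y : continuous (truncated_dist y).
Proof.
move=> x; apply/cvgrPdist_le => e e0; near=> x'.
apply: le_trans (truncated_dist_lip _ _ _) _.
suff : ball x e x' by rewrite ballEmdist => /ltW.
by near: x'; exact: nbhsx_ballx.
Unshelve. all: by end_near. Qed.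

Lemma truncated_dist_separates : separate_points_from_closed truncated_dist.
Proof.
(* The coordinate indexed by [x] itself separates: it is 0 at [x] and bounded below by a positive
   constant on [U]. *)
move=> U x clU nUx; exists x.
have /nbhs_ballP[e /= e0 eU] : nbhs x (~` U).
  by apply: open_nbhs_nbhs; split=> //; exact: closed_openC.
have clV : closed [set r : R | Num.min 1 e <= r] by exact: closed_ge.
have UV : truncated_dist x @` U `<=` [set r : R | Num.min 1 e <= r].
  move=> _ [y Uy <-] /=; rewrite le_min2//.
  rewrite leNgt; apply/negP => yx; apply: (eU y) => //.
  by rewrite ballEmdist /= metric_sym.
move=> /(subset_trans (closureS UV) clV) /=.
by rewrite /truncated_dist mdistxx leNgt gt_min !lt_min ltr01 e0 orbT.
Qed.

Lemma truncated_dist_embedding : embedding k.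
Proof.
have ik : set_inj [set: M] k.
  apply: join_product_inj; first exact: truncated_dist_separates.
  by apply: hausdorff_accessible; exact: metric_hausdorff.
split; first by move=> x y kxy; apply: ik => //; rewrite inE.
move=> U; rewrite (join_product_initial truncated_dist_separates) //.
exact: truncated_dist_continuous.
Qed.

(** Approximate [p] by the image of a point [x] in the coordinates [y] and [z] only. As [p y < 1],
    the truncation is inactive at [y], so [x] is almost within [p y] of [y], and the Lipschitz bound
    passes to the limit. *)
Lemma closure_truncated_dist (p : P) y z : closure (range k) p -> p y < 1 ->
  `|p z - truncated_dist z y| <= p y.
Proof.
move=> clp py1; apply/ler_addgt0Pl => e e0.
(* Half of [e] for each of the two coordinates; the bound [1 - p y] keeps [p y + d] at most 1, so
   that the truncated distance controls the true one. *)
pose d := Num.min (e / 2) (1 - p y).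
have d0 : 0 < d by rewrite lt_min divr_gt0// subr_gt0.
have near_p w : nbhs p [set q : P | `|p w - q w| < d].
  have pw : (q w : R) @[q --> p] --> (p w : R).
    exact: (@proj_continuous M (fun=> R) w p).
  exact: (@cvgr_dist_lt R R P (nbhs p) _ (fun q : P => q w) (p w) pw d d0).
have [_ [[x _ <-] [xy xz]]] := clp _ (filterI (near_p y) (near_p z)).
have xy' : mdist x y < p y + d.
  move: xy; rewrite /= /join_product /truncated_dist ltr_norml => /andP[+ _].
  have : d <= 1 - p y by rewrite ge_min lexx orbT.
  by case: (leP 1 (mdist x y)) => ? ? ?; lra.
have := truncated_dist_lip x y z.
have : d <= e / 2 by rewrite ge_min lexx.
move: xz; rewrite /= /join_product ltr_norml !ler_norml => /andP[? ?] ? /andP[? ?].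
by apply/andP; split; lra.
Qed.

(** Points at which the coordinates of [p] tend to 0 form a Cauchy sequence, and the image of its
    limit agrees with [p] in every coordinate. *)
Lemma complete_range_closure (p : P) : complete_metric M ->
  closure (range k) p -> (forall n, exists y, p y < n.+2%:R^-1) -> range k p.
Proof.
move=> cM clp /choice[y yP].
have y2 n : p (y n) < 2^-1.
  by apply: lt_le_trans (yP n) _; rewrite lef_pV2 ?posrE// ler_nat.
have small (e : R) : 0 < e -> \forall n \near \oo, p (y n) < e.
  move=> e0; exists (Num.truncn e^-1) => // n /= en.
  apply: lt_le_trans (yP n) _.
  rewrite -[leRHS]invrK lef_pV2 ?posrE ?invr_gt0//.
  by rewrite (le_trans (ltW (truncnS_gt _)))// ler_nat ltnS ltnW// ltnS.
have py1 n : p (y n) < 1 by apply: lt_trans (y2 n) _; rewrite invf_lt1// ltr1n.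
(* Both summands are below 1/2, thanks to [n.+2], so a distance of at least 1, which truncation
   would hide, is excluded. *)
have dy m n : mdist (y m) (y n) <= p (y m) + p (y n).
  have := closure_truncated_dist (y n) clp (py1 m).
  rewrite ler_norml => /andP[+ _]; rewrite /truncated_dist.
  have := y2 n; have := y2 m.
  by case: (leP 1 (mdist (y m) (y n))) => *; lra.
have [] := cM (y @ \oo).
  apply/cauchy_exP => e e0.
  have e20 : 0 < e / 2 by rewrite divr_gt0.
  have [N _ NP] := small _ e20.
  exists (y N), N => // n Nn /=; rewrite ballEmdist /=.
  apply: le_lt_trans (dy N n) _.
  by have := NP _ Nn; have := NP N (leqnn N); rewrite /=; lra.
move=> x yx; exists x => //; apply/funext => z; apply/eqP.
rewrite eq_sym -subr_eq0 -normr_le0; apply/ler_addgt0Pl => e e0; rewrite addr0.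
have e20 : 0 < e / 2 by rewrite divr_gt0.
have yxe : \forall n \near \oo, mdist x (y n) < e / 2.
  exact: (metricType_numDomainType.cvgr_dist_lt yx).
have [n [pn xn]] := filter_ex (filterI (small _ e20) yxe).
have := closure_truncated_dist z clp (py1 n).
have := truncated_dist_lip x (y n) z.
rewrite /join_product !ler_norml => /andP[? ?] /andP[? ?].
by apply/andP; split; lra.
Qed.

Lemma complete_metric_cech_complete : complete_metric M -> cech_complete M.
Proof.
move=> cM; split.
  by split; [exact: metric_hausdorff|exact: (@uniform_completely_regular R)].
exists (closure (range k)), (corestrict_closure k); split.
  apply: (@closure_compactification _ _ _
    [set q : P | forall y, `[0, 1]%classic (q y : R)]).
  - exact: truncated_dist_embedding.
  - by apply: hausdorff_product => _; exact: Rhausdorff.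
  - apply: (@tychonoff M (fun=> R) (fun=> `[0, 1]%classic)) => _.
    exact: segment_compact.
  - move=> _ [x _ <-] y /=; rewrite in_itv /= /join_product /truncated_dist.
    by rewrite le_min ler01 mdist_ge0 ge_min lexx.
(* Membership in all [G n] says that the infimum of the coordinates is 0; at the image of [x] the
   coordinate indexed by [x] attains it. *)
pose G n : set P := \bigcup_y [set q : P | q y < n.+2%:R^-1].
have oG n : open (G n).
  apply: bigcup_open => y _.
  apply: (@open_comp P R (fun q : P => q y) [set r | r < n.+2%:R^-1]).
    by move=> q _; exact: (@proj_continuous M (fun=> R) y).
  exact: open_lt.
exists (fun n => set_val @^-1` G n); first by move=> n; exists (G n).
apply/seteqP; split=> [_ [x _ <-] n _|p Gp].
  exists x => //; suff : truncated_dist x x < n.+2%:R^-1 by [].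
  rewrite /truncated_dist mdistxx.
  by rewrite gt_min invr_gt0 ltr0n orbT.
have [] := @complete_range_closure (set_val p) cM (set_valP p).
  by move=> n; have [y _ yP] := Gp n I; exists y.
by move=> x _ kxp; exists x => //; apply: val_inj.
Qed.

End truncated_distance.

(** * Fine neighbourhoods and the obstruction given by an unbounded function *)

(** Base balls can be recentred at any of their points [f]: the slack [e - |g - f|] is again a
    positive continuous radius. *)
Lemma fine_openP (R : realType) (X : topologicalType) (U : set (Cw R X)) :
  open U <-> forall f : continuousType X R, U f ->
    exists e : X -> R, [/\ continuous e, forall x, 0 < e x & fine_ball f e `<=` U].
Proof.
split=> [[D Dpos <-] f [[g e] /[dup] /Dpos /= e0 Dge fge]|].
  exists (fun x => e x - `|g x - f x|); split.
  - move=> x; apply: cvgB; first exact: cts_fun.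
    by apply: cvg_norm; apply: cvgB; exact: cts_fun.
  - by move=> x; rewrite subr_gt0; exact: fge.
  - move=> h fh; exists (g, e) => //= x.
    rewrite (le_lt_trans (ler_distD (f x) _ _))// addrC -ltrBrDr.
    exact: fh.
move=> H.
exists [set fe | fine_base_index fe /\ fine_base fe `<=` U]; first by move=> ? [].
apply/seteqP; split=> [g [fe [_ +]]|g Ug]; first exact.
have [e [ce e0 eU]] := H g Ug.
exists ((g : continuousType X R), (mkcts ce : continuousType X R)) => //.
by move=> x /=; rewrite subrr normr0; exact: e0.
Qed.

Lemma positive_minorant (R : realType) (e t : nat -> R) :
    (forall m, 0 < e m) -> (forall m, m%:R < t m) ->
  exists phi : R -> R,
    [/\ continuous phi, forall s, 0 < phi s & forall m, phi (t m) <= e m].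
Proof.
(* The infimum is positive at [s] because [t m > m] leaves only finitely many
   [t m] within distance 1 of [s]. *)
move=> e0 mt; pose E s := range (fun m => e m + `|s - t m|).
have E0 s : E s !=set0 by exists (e 0%N + `|s - t 0%N|); exists 0%N.
have lbE s : has_lbound (E s).
  by exists 0 => _ [m _ <-]; rewrite addr_ge0// ltW.
have leE s m : inf (E s) <= e m + `|s - t m|.
  by apply: ge_inf => //; exists m.
(* An infimum of 1-Lipschitz functions is 1-Lipschitz, whence continuity. *)
have lip s s' : inf (E s) <= inf (E s') + `|s - s'|.
  rewrite -lerBlDr; apply: lb_le_inf => // _ [m _ <-].
  rewrite lerBlDr (le_trans (leE s m))// -addrA lerD2l addrC.
  exact: ler_distD.
exists (fun s => inf (E s)); split.
- move=> s; apply/cvgrPdist_le => d d0; near=> s'.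
  have ss' : `|s - s'| <= d by near: s'; exact: cvgr_dist_le.
  rewrite ler_norml lerBlDr lerBrDr addrC; apply/andP; split.
    by rewrite lerBlDr (le_trans (lip s' s))// lerD2l distrC.
  by rewrite addrC (le_trans (lip s s'))// lerD2l.
- move=> s.
  have [d d0 dle] : exists2 d, 0 < d & forall m, d <= e m + `|s - t m|.
    have small N : exists2 d, 0 < d & forall m, (m < N)%N -> d <= e m.
      elim: N => [|N [d d0 dN]]; first by exists 1.
      exists (Num.min d (e N)); first by rewrite lt_min d0 e0.
      move=> m; rewrite ltnS leq_eqVlt => /orP[/eqP ->|mN].
        by rewrite ge_min lexx orbT.
      by rewrite ge_min dN.
    have [d d0 dN] := small (Num.truncn (s + 1)).+1.
    exists (Num.min d 1); first by rewrite lt_min d0 ltr01.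
    move=> m; have [mN|Nm] := ltnP m (Num.truncn (s + 1)).+1.
      by rewrite ge_min (le_trans (dN m mN))// lerDl.
    have s1m : s + 1 < t m.
      by rewrite (lt_trans (truncnS_gt _))// (le_lt_trans _ (mt m))// ler_nat.
    have em := e0 m; rewrite ge_min; apply/orP; right.
    by rewrite distrC (le_trans _ (lerD (ltW em) (ler_norm _)))//; lra.
  by apply: lt_le_trans d0 _; apply: lb_le_inf => // _ [m _ <-].
- by move=> m; rewrite (le_trans (leE _ m))// subrr normr0 addr0.
Unshelve. all: by end_near. Qed.

Lemma hereditarily_baire_pseudocompact (R : realType) (X : topologicalType) :
  hereditarily_baire (Cw R X) -> pseudocompact R X.
Proof.
move=> hb f cf; apply: contrapT => nbf.
pose F x := `|f x|.
have cF : continuous F by move=> x; apply: cvg_norm; exact: cf.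
have unb (M : R) : exists x, M < F x.
  apply: contrapT => /forallNP H; apply: nbf; exists M; split; first exact: num_real.
  move=> M' MM' x _; apply: le_trans (ltW MM').
  by rewrite leNgt; apply/negP; exact: H.
pose vanish (m : nat) (g : X -> R) := forall x, m%:R < F x -> g x = 0.
pose A : set (Cw R X) :=
  [set g | exists m, vanish m (g : continuousType X R)].
have clA : closed A.
  (* A function [g] outside [A] is nonzero at some [xs m] with [F (xs m) > m], for every [m]. A
     radius at most [|g (xs m)|] at each [xs m] keeps every [h] in the ball nonzero there, hence
     outside [A]. *)
  rewrite -openC; apply/fine_openP => g nAg.
  have /choice[xs xsP] m : exists x, m%:R < F x /\ g x <> 0.
    apply: contrapT => /forallNP H; apply: nAg; exists m => x mx.
    by apply: contrapT => gx; apply: (H x).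
  have [| |phi [cphi phi0 phile]] :=
    @positive_minorant R (fun m => `|g (xs m)|) (fun m => F (xs m)).
  - by move=> m; rewrite normr_gt0; apply/eqP; case: (xsP m).
  - by move=> m; case: (xsP m).
  exists (phi \o F); split=> //.
  - by move=> x; apply: continuous_comp; [exact: cF|exact: cphi].
  - by move=> x; exact: phi0.
  - move=> h gh [m mh]; have := gh (xs m).
    rewrite mh; last by case: (xsP m).
    by rewrite subr0 ltNge phile.
have A0 : A !=set0 by exists (cst 0 : continuousType X R), 0%N.
pose W m : set (Cw R X) := [set g | ~ vanish m (g : continuousType X R)].
have oW m : open (W m).
  apply/fine_openP => g /existsNP[x /not_implyP[mx gx]].
  exists (cst `|g x|); split.
  - by move=> y; exact: cvg_cst.
  - by move=> y; rewrite normr_gt0; exact/eqP.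
  - move=> h gh hm; have := gh x.
    by rewrite hm// subr0 ltxx.
have dW m : dense (set_val @^-1` W m : set A).
  move=> O [a Oa] [V oV VO].
  have [k ak] := set_valP a.
  have Va : V (val a) by move: Oa; rewrite -VO.
  have [e [ce e0 eV]] := (fine_openP V).1 oV _ Va.
  (* Beyond [k] the function [a] vanishes, so a bump at [x0] makes it nonzero there; beyond [m] this
     destroys [vanish m]. *)
  have [x0 x0P] := unb (maxn k m)%:R.
  (* The bump is below [e], positive at [x0], and zero wherever [F] differs from [F x0] by at least
     1. *)
  pose b := (fun x => e x / 2) \min
    ((fun=> 0) \max (fun x => 1 - `|F x - F x0|)).
  have cb : continuous b.
    move=> x; apply: continuous_min.
      by apply: cvgM; [exact: ce|exact: cvg_cst].
    apply: continuous_max; first exact: cvg_cst.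
    apply: cvgB; first exact: cvg_cst.
    by apply: cvg_norm; apply: cvgB; [exact: cF|exact: cvg_cst].
  have cg : continuous (fun x => (val a : continuousType X R) x + b x).
    by move=> x; apply: cvgD; [exact: cts_fun|exact: cb].
  pose g : Cw R X := (mkcts cg : continuousType X R).
  have Ag : A g.
    (* Where [F] exceeds this index, [a] vanishes and [F > F x0 + 1] puts the point outside the
       bump. *)
    exists (maxn k (Num.truncn (F x0 + 1)).+1) => x kx.
    have kx' : k%:R < F x by rewrite (le_lt_trans _ kx)// ler_nat leq_maxl.
    have x0x : F x0 + 1 < F x.
      rewrite (lt_le_trans (truncnS_gt _))// (le_trans _ (ltW kx))// ler_nat.
      exact: leq_maxr.
    suff : (val a : continuousType X R) x + b x = 0 by [].
    rewrite [X in X + _](ak x kx') add0r /b /=.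
    have -> : Num.max 0 (1 - `|F x - F x0|) = 0.
      by apply/max_idPl; rewrite subr_le0 (le_trans _ (ler_norm _))//; lra.
    by apply/min_idPr; rewrite divr_ge0// ltW.
  exists (exist _ g (mem_set Ag)); split.
    rewrite -VO; apply: eV => x /=.
    have b0 : 0 <= b x by rewrite le_min le_max lexx /= andbT divr_ge0// ltW.
    rewrite /mkcts opprD addrA subrr sub0r normrN ger0_norm//.
    by have := e0 x; rewrite gt_min => ?; apply/orP; left; lra.
  move=> gm.
  have bx0 : b x0 = 0.
    have mx0 : m%:R < F x0 by rewrite (le_lt_trans _ x0P)// ler_nat leq_maxr.
    have kx0 : k%:R < F x0 by rewrite (le_lt_trans _ x0P)// ler_nat leq_maxl.
    have : (val a : continuousType X R) x0 + b x0 = 0 by exact: gm mx0.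
    by rewrite [X in X + _](ak x0 kx0) add0r.
  have : 0 < b x0.
    by rewrite /b /= subrr normr0 subr0 lt_min lt_max ltr01 orbT andbT divr_gt0.
  by rewrite bx0 ltxx.
(* A point of [A] common to all [W m] vanishes on no [{F > m}], contradicting membership in [A]. *)
have [|||g [_ Wg]] := hb A clA A0 (fun m => set_val @^-1` W m) _ setT.
- by move=> m; split; [exists (W m)|exact: dW].
- by have [g Ag] := A0; exists (exist _ g (mem_set Ag)).
- exact: openT.
by have [m mg] := set_valP g; exact: (Wg m).
Qed.

(** * The complete sup metric for pseudocompact [X] *)

(** Adjoining 0 keeps the set nonempty when [X] is empty and otherwise leaves the supremum
    unchanged. *)
Definition sup_dist (R : realType) (X : Type) (f g : X -> R) : R :=
  sup (0 |` range (fun x => `|f x - g x|)).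

Lemma sup_dist_leP (R : realType) (X : topologicalType)
    (f g : continuousType X R) (e : R) :
    pseudocompact R X -> 0 <= e ->
  sup_dist f g <= e <-> forall x, `|f x - g x| <= e.
Proof.
move=> pX e0; split=> [fge x|fge]; last first.
  by apply: ge_sup; [exists 0; left|move=> _ [->//|[x _ <-]]; exact: fge].
apply: le_trans fge; apply: ub_le_sup; last by right; exists x.
have cfg : continuous (fun x => f x - g x : R).
  by move=> y; apply: cvgB; exact: cts_fun.
have [M [_ MP]] := pX _ cfg.
(* Boundedness only makes the numbers strictly above [M] bounds, hence [M + 1]; the maximum covers
   the adjoined 0. *)
exists (Num.max 0 (M + 1)) => _ [->|[y _ <-]]; rewrite le_max ?lexx//.
by rewrite (MP (M + 1)) ?orbT// ltrDl.
Qed.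

Section sup_metric.
Variables (R : realType) (X : topologicalType) (pX : pseudocompact R X).

(* The index [pX] keeps the metric, which only exists on pseudocompact spaces,
   from becoming an instance on every [continuousType]. *)
Definition Csup of pseudocompact R X : Type := continuousType X R.

HB.instance Definition _ := Choice.copy (Csup pX) (continuousType X R).

Let dist (f g : Csup pX) : R :=
  sup_dist (f : continuousType X R) (g : continuousType X R).

Let dist_ge0 f g : 0 <= dist f g.
Proof.
rewrite leNgt; apply/negP => fg0.
have := (sup_dist_leP (f : continuousType X R) (g : continuousType X R) pX
  (lexx 0)).1 (ltW fg0).
move=> fg; move: fg0; rewrite /dist /sup_dist.
rewrite (_ : _ |` _ = [set 0]) ?sup1 ?ltxx//; apply/seteqP.
split=> z; last by move=> ->; left.
move=> [->//|[x _ <-]] /=.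
by apply/eqP; rewrite eq_le fg normr_ge0.
Qed.

Let dist_le f g e (e0 : 0 <= e) :
  dist f g <= e <->
  forall x, `|(f : continuousType X R) x - (g : continuousType X R) x| <= e.
Proof. exact: sup_dist_leP. Qed.

Let le_dist f g x :
  `|(f : continuousType X R) x - (g : continuousType X R) x| <= dist f g.
Proof. by apply: (dist_le f g (dist_ge0 f g)).1. Qed.

Let distxx f : dist f f = 0.
Proof.
apply/eqP; rewrite eq_le dist_ge0 andbT; apply: (dist_le f f (lexx 0)).2 => x.
by rewrite subrr normr0.
Qed.

Let dist_positivity f g : dist f g = 0 -> f = g.
Proof.
move=> fg0; apply/continuousEP => x; apply/eqP; rewrite -subr_eq0 -normr_le0.
by rewrite -fg0 le_dist.
Qed.

Let dist_sym f g : dist f g = dist g f.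
Proof.
rewrite /dist /sup_dist; congr (sup (_ |` _)).
by apply: eq_imagel => x _; exact: distrC.
Qed.

Let dist_triangle g f h : dist f h <= dist f g + dist g h.
Proof.
apply: (dist_le f h (addr_ge0 (dist_ge0 f g) (dist_ge0 g h))).2 => x.
apply: le_trans (ler_distD ((g : continuousType X R) x) _ _) _.
by rewrite lerD.
Qed.

HB.instance Definition _ := @isMetric.Build R (Csup pX)
  dist distxx dist_positivity dist_sym dist_triangle.

Lemma Csup_mdist_leP (f g : Csup pX) (e : R) : 0 <= e ->
  mdist f g <= e <->
  forall x, `|(f : continuousType X R) x - (g : continuousType X R) x| <= e.
Proof. exact: dist_le. Qed.

(** Pointwise limits exist by completeness of the reals; the Cauchy condition makes the convergence
    uniform, so the limit is continuous. *)
Lemma Csup_complete : complete_metric (Csup pX).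
Proof.
move=> F PF cF.
pose ev x (f : Csup pX) : R := (f : continuousType X R) x.
have ev_le x f g : `|ev x f - ev x g| <= mdist f g by exact: le_dist.
have cevF x : cvg (ev x @ F).
  apply: cauchy_cvg; apply/cauchy_exP => e e0.
  have [f Ff] := (cauchyP F).1 cF e e0.
  exists (ev x f); rewrite /fmapE /=; near=> g.
  rewrite -ball_normE /=; apply: le_lt_trans (ev_le x f g) _.
  have : ball f e g by near: g.
  by rewrite ballEmdist.
pose l x := lim (ev x @ F).
have Fl e : 0 < e -> \forall f \near F, forall x, `|ev x f - l x| <= e.
  move=> e0.
  have := (cauchy_ballP F).2 cF e e0.
  rewrite near_simpl => -[[A B] /= [FA FB] AB].
  near=> f => x.
  (* With [f] fixed, [g] runs along [F] and the closed condition passes to the limit at [x]. *)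
  rewrite distrC; apply: (@closed_cvg _ _ F _ (ev x) [set y | `|y - ev x f| <= e]).
  - rewrite (_ : [set _ | _] = closed_ball_ Num.norm (ev x f) e).
      exact: closed_closed_ball_.
    by apply/seteqP; split=> y /=; rewrite distrC.
  - near=> g; rewrite /= distrC (le_trans (ev_le x f g))// ltW//.
    have : ball f e g.
      by apply: (AB (f, g)); split=> /=; [near: f|near: g].
    by rewrite ballEmdist.
  - exact: cevF.
have cl : continuous l.
  move=> x; apply/cvgrPdist_le => e e0.
  have e30 : 0 < e / 3 by rewrite divr_gt0.
  have [f fl] := filter_ex (Fl _ e30).
  have cf : {for x, continuous (f : continuousType X R)} by exact: cts_fun.
  near=> y.
  have fxy : `|ev x f - ev y f| <= e / 3.
    by near: y; move: cf => /cvgrPdist_le; exact.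
  have flx := fl x; have fly := fl y.
  move: fxy flx fly; rewrite !ler_norml => /andP[? ?] /andP[? ?] /andP[? ?].
  by apply/andP; split; lra.
exists (mkcts cl : continuousType X R).
apply/metricType_numDomainType.cvgrPdist_le => e e0.
near=> f; rewrite metric_sym; apply/Csup_mdist_leP; first exact: ltW.
by near: f; exact: Fl.
Unshelve. all: by end_near. Qed.

(** The reciprocal of [e] is continuous, hence bounded. *)
Lemma pseudocompact_bounded_away (e : X -> R) :
  continuous e -> (forall x, 0 < e x) -> exists2 d, 0 < d & forall x, d <= e x.
Proof.
move=> ce e0.
have cV : continuous (fun x => (e x)^-1).
  by move=> x; apply: cvgV; [rewrite gt_eqF|exact: ce].
have [M [_ MP]] := pX cV.
exists (Num.max 1 (M + 1))^-1; first by rewrite invr_gt0 lt_max ltr01.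
move=> x; rewrite -[leRHS]invrK lef_pV2 ?posrE ?invr_gt0 ?lt_max ?ltr01//.
rewrite le_max; apply/orP; right; apply: le_trans (ler_norm _) _.
by apply: (MP (M + 1)) => //; rewrite ltrDl.
Qed.

Lemma pseudocompact_completely_metrizable : completely_metrizable R (Cw R X).
Proof.
exists (Csup pX), (id : Cw R X -> Csup pX); split; last exact: Csup_complete.
split; last by apply/seteqP; split=> // f _; exists f.
split=> // U; split=> [oU|[V oV <-]].
  exists U => //; rewrite openE => f Uf.
  have [e [ce e0 eU]] := (fine_openP U).1 oU f Uf.
  have [d d0 de] := pseudocompact_bounded_away ce e0.
  apply/nbhs_ballP; exists d => // g; rewrite ballEmdist /= => fg.
  apply: eU => x; apply: lt_le_trans (de x).
  apply: le_lt_trans fg; exact: (Csup_mdist_leP f g (mdist_ge0 _ _)).1.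
apply/fine_openP => f Vf.
have /nbhs_ballP[e /= e0 eV] : nbhs (f : Csup pX) V by apply: open_nbhs_nbhs.
have e20 : 0 < e / 2 by rewrite divr_gt0.
(* Strict pointwise bounds give only a weak bound on the supremum, so the radius is halved. *)
exists (cst (e / 2)); split=> //.
  by move=> x; exact: cvg_cst.
move=> g fg; apply: eV; rewrite ballEmdist /=.
apply: (@le_lt_trans _ _ (e / 2)); last lra.
by apply/Csup_mdist_leP => [|x]; exact: ltW.
Qed.

End sup_metric.

Theorem theorem2p2 (R : realType) (X : topologicalType)
    (hX : tychonoff_space X) :
  [<-> completely_metrizable R (Cw R X);
       cech_complete (Cw R X);
       sieve_complete (Cw R X);
       hereditarily_baire (Cw R X);
       pseudocompact R X].
Proof.
tfae.
- move=> [M [h [hh cM]]].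
  exact: homeomorphism_cech_complete hh (complete_metric_cech_complete cM).
- move=> cC; exists (Cw R X), idfun; split=> //.
  + by move=> f; exact: cvg_id.
  + by move=> U oU; rewrite (image_id U).
  + exact: image_id.
- exact: sieve_complete_hereditarily_baire.
- exact: hereditarily_baire_pseudocompact.
- exact: pseudocompact_completely_metrizable.
Qed.
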